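(* Let $B_2^4\subset\mathbb{R}^4$ be the Euclidean unit ball and let $\mathfrak S=2B_2^4$. Then $$\Delta(\mathfrak S\times\mathfrak S)<\Delta(\mathfrak S)^2 .$$ More explicitly, $$\Delta(\mathfrak S\times\mathfrak S)\ \le\ \frac{256}{(1+1/\sqrt5)^4}=58.359213\ldots\ <\ 64=\Delta(\mathfrak S)^2 .$$
   Context: For an origin-symmetric convex body $\mathfrak T\subset\mathbb{R}^n$, its critical determinant is $$\Delta(\mathfrak T)=\inf\{\operatorname{covol}(\Lambda): (\Lambda\setminus\{0\})\cap\operatorname{int}(\mathfrak T)=\varnothing\},$$ where the infimum is over full-rank lattices $\Lambda\subset\mathbb{R}^n$ and $\operatorname{covol}$ denotes covolume. The Cartesian product $\mathfrak S\times\mathfrak S$ is regarded as a convex body in $\mathbb{R}^8=\mathbb{R}^4\oplus\mathbb{R}^4$. *)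

(* Defs.v *)
From mathcomp Require Import all_boot all_order all_algebra.
From mathcomp Require Import all_classical all_reals all_analysis.

Set Implicit Arguments.
Unset Strict Implicit.
Unset Printing Implicit Defensive.

Import Order.TTheory GRing.Theory Num.Theory.
Import numFieldNormedType.Exports.

Local Open Scope classical_set_scope.
Local Open Scope ring_scope.

Definition euclidean_norm (R : realType) (n : nat) (x : 'rV[R]_n) : R :=
  Num.sqrt (\sum_(i < n) x 0 i ^+ 2).

Definition unit_ball (R : realType) (n : nat) : set 'rV[R]_n :=
  [set x | euclidean_norm x <= 1].

Definition cart_prod (R : realType) (m n : nat)
    (S : set 'rV[R]_m) (T : set 'rV[R]_n) : set 'rV[R]_(m + n) :=
  [set row_mx x y | x in S & y in T].

(** The rows of [B] form an R-basis of R^n whose Z-span is [L]. *)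
Definition lattice_basis (R : realType) (n : nat)
    (L : set 'rV[R]_n) (B : 'M[R]_n) : Prop :=
  B \in unitmx /\ L = [set map_mx intr z *m B | z in [set: 'rV[int]_n]].

Definition full_rank_lattice (R : realType) (n : nat) (L : set 'rV[R]_n) : Prop :=
  exists B : 'M[R]_n, lattice_basis L B.

(** [xget] picks some basis; the value does not depend on it ([covolE]). The
    default, the zero matrix, is only used when [L] is not a full-rank lattice. *)
Definition covol (R : realType) (n : nat) (L : set 'rV[R]_n) : R :=
  `|\det (xget 0 [set B : 'M[R]_n | lattice_basis L B])|.

(** [T°] is taken in the canonical topology of ['rV[R]_n] (induced by the sup
    norm), which is the usual topology of R^n. The set of covolumes is bounded
    below by 0, and nonempty as soon as [T] is bounded. *)
Definition critical_determinant (R : realType) (n : nat) (T : set 'rV[R]_n) : R :=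
  inf [set covol L | L in [set L : set 'rV[R]_n |
    full_rank_lattice L /\ (L `\ 0) `&` T° = set0]].

Lemma lattice_basis_change (R : realType) (n : nat) (L : set 'rV[R]_n)
    (B C : 'M[R]_n) : lattice_basis L B -> lattice_basis L C ->
  exists U : 'M[int]_n, B = map_mx intr U *m C.
Proof.
move=> [uB LB] [uC LC].
have rowB i : exists z : 'rV[int]_n, map_mx intr z *m C = row i B.
  have : L (row i B).
    by rewrite LB; exists (delta_mx 0 i) => //; rewrite map_delta_mx -rowE.
  by rewrite LC => -[z _ zE]; exists z.
have [z zE] := choice rowB.
exists (\matrix_(i, j) z i 0 j); apply/row_matrixP => i.
rewrite row_mul -zE; congr (_ *m _).
by apply/rowP => j; rewrite !mxE.
Qed.

Lemma covolE (R : realType) (n : nat) (L : set 'rV[R]_n) (B : 'M[R]_n) :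
  lattice_basis L B -> covol L = `|\det B|.
Proof.
move=> LB; rewrite /covol; case: xgetP => [C _ /= LC|/(_ B)//].
have [U UE] := lattice_basis_change LB LC.
have [V VE] := lattice_basis_change LC LB.
have [uB _] := LB; have [uC _] := LC.
have dB : \det B != 0 by rewrite -unitfE -unitmxE.
have normU : `|\det U| = 1.
  have /eqP : \det B = (\det U)%:~R * (\det V)%:~R * \det B.
    by rewrite -mulrA {1}UE {1}VE !det_mulmx !det_map_mx.
  rewrite -{1}[\det B]mul1r (inj_eq (mulIf dB)) -intrM.
  rewrite -[X in X == _]/(1%:~R) eqr_int eq_sym => /eqP UV1.
  have : \det U \is a GRing.unit.
    by apply/unitrP; exists (\det V); rewrite mulrC UV1.
  by case/orP => /eqP ->.
by rewrite {1}UE det_mulmx det_map_mx normrM -intr_norm normU mul1r.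
Qed.

(* Main.v *)
Require Import Defs.
From mathcomp Require Import all_boot all_order all_algebra.
From mathcomp Require Import all_classical all_reals all_analysis.
From mathcomp Require Import ring lra zify.
Import Order.TTheory GRing.Theory Num.Theory.
Import numFieldNormedType.Exports.
Local Open Scope classical_set_scope.
Local Open Scope ring_scope.

Set Implicit Arguments.
Unset Strict Implicit.
Unset Printing Implicit Defensive.

(** The value of the critical determinant of the ball of radius 2 in dimension 4
    amounts to Hermite's constant: a lattice of rank 4 whose nonzero vectors have
    squared norm at least [m] satisfies [m ^ 4 <= 4 * covol ^ 2], with equality
    for the Hurwitz quaternions. In dimension 3, a basis of minimal total squared
    length is Minkowski reduced, and Gauss' inequality gives
    [m ^ 3 <= 2 * covol ^ 2]. Applied to the section of a lattice orthogonal to a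
    dual vector (Mordell), this bounds the minimum of the lattice by that of its
    dual, and conversely; the two bounds combine into the one in dimension 4.

    For the product, let [t] be the golden ratio, [u = 1 - t] its conjugate and
    take the vectors [2 (x, x' / t)], with [x] an icosian and [x'] its conjugate.
    The norm of [x] is [a = P + Q t] in [Z[t]], and [x'] has norm [a' = P + Q u];
    both are nonnegative, and no nonzero such pair satisfies [a < 1] and
    [a' < t ^ 2]. The covolume is [400 / t ^ 4]. *)

(** * Determinants of reduced ternary forms *)

(** The determinant of the symmetric matrix with diagonal [a], [b], [c] in which [f], [g], [h] stand
    opposite to them: [f] at (2,3), [g] at (1,3), [h] at (1,2). *)
Definition det3 (R : comNzRingType) (a b c f g h : R) : R :=
  a * b * c + 2 * f * g * h - a * f ^+ 2 - b * g ^+ 2 - c * h ^+ 2.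

Lemma double_sqr_le (R : realFieldType) (a b h : R) : 0 < a -> a <= b -> 0 <= h ->
  2 * h <= a -> 2 * h ^+ 2 <= a * b.
Proof.
move=> a0 ab h0 ha.
have ? : 0 <= (a - 2 * h) * h by apply: mulr_ge0; lra.
have ? : 0 <= (b - a) * a by apply: mulr_ge0; lra.
have ? : 0 <= (a - 2 * h) * a by apply: mulr_ge0; lra.
nra.
Qed.

(* The squares are bounded by [f ^ 2 <= b f / 2] and likewise for [g] and [h];
   what remains is affine in [f], hence is checked at [f = 0] and [f = b / 2]. *)
Lemma acute_det3_ge (R : realFieldType) (a b c f g h : R) : 0 < a -> a <= b ->
  b <= c -> 0 <= f -> 0 <= g -> 0 <= h ->
  2 * g <= a -> 2 * h <= a -> 2 * f <= b -> a * b * c <= 2 * det3 a b c f g h.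
Proof.
move=> a0 le_ab le_bc f0 g0 h0 le_ga le_ha le_fb; rewrite /det3.
have q := double_sqr_le a0 le_ab h0 le_ha.
have c1 : 0 <= (c - b) * (a * b - 2 * h ^+ 2) by apply: mulr_ge0; lra.
have c2 : 0 <= a * f * (b - 2 * f) by rewrite !mulr_ge0 //; lra.
have c3 : 0 <= b * g * (a - 2 * g) by rewrite !mulr_ge0 //; lra.
have c4 : 0 <= b * h * (a - 2 * h) by rewrite !mulr_ge0 //; lra.
have d1 : 0 <= (b - 2 * f) * (a * b ^+ 2 - a * b * g - a * b * h).
  rewrite (_ : a * b ^+ 2 - _ - _ = a * b * (b - g - h)) ?mulr_ge0 //; try lra;
    ring.
have d2 : 0 <= 2 * f * (a * b ^+ 2 / 2 + 2 * b * g * h - a * b * g - a * b * h).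
  rewrite (_ : a * b ^+ 2 / 2 + _ - _ - _ = b / 2 * ((a - 2 * g) * (a - 2 * h) + a
    * (b - a))); last by field.
  by rewrite !mulr_ge0 ?addr_ge0 ?mulr_ge0 //; lra.
have b0 : 0 < b by lra.
(* The factor [b] comes from interpolation: [b] times an affine function of [f] is [b - 2 f] times
   its value at 0 ([d1]) plus [2 f] times its value at [b / 2] ([d2]). *)
suff : 0 <= b * (a * b * c + 4 * f * g * h - 2 * a * f ^+ 2 - 2 * b * g ^+ 2 - 2 *
  c * h ^+ 2).
  rewrite pmulr_rge0 //; lra.
have := mulr_ge0 (ltW b0) c1; have := mulr_ge0 (ltW b0) c2;
have := mulr_ge0 (ltW b0) c3; have := mulr_ge0 (ltW b0) c4; lra.
Qed.

(* The difference is decreasing in [f], so [f] may be replaced by the largest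
   value allowed: [b / 2], or the one saturating the last hypothesis. *)
Lemma obtuse_det3_ge (R : realFieldType) (a b c f g h : R) : 0 < a -> a <= b ->
  b <= c -> 0 <= f -> 0 <= g -> 0 <= h ->
  2 * g <= a -> 2 * h <= a -> 2 * f <= b -> 2 * (f + g + h) <= a + b ->
    a * b * c <= 2 * det3 a b c f g (- h).
Proof.
move=> a0 le_ab le_bc f0 g0 h0 le_ga le_ha le_fb le_sum; rewrite /det3.
have q := double_sqr_le a0 le_ab h0 le_ha.
have c1 : 0 <= (c - b) * (a * b - 2 * h ^+ 2) by apply: mulr_ge0; lra.
suff : 4 * f * g * h + 2 * a * f ^+ 2 + 2 * b * g ^+ 2 + 2 * b * h ^+ 2 <=
  a * b ^+ 2 by lra.
(* The bound [f <= b / 2] is the stronger one exactly when [2 (g + h) <= a]. *)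
have [sm|sm] := leP (2 * (g + h)) a.
  have d1 : 0 <= (b - 2 * f) * (a * (b + 2 * f) + 4 * g * h).
    apply: mulr_ge0; first lra.
    by apply: addr_ge0; rewrite !mulr_ge0 //; lra.
  have d2 : 0 <= b * ((a - 2 * (g + h)) * (a + 2 * (g + h)) + 4 * g * h + a * (b -
    a)).
    apply: mulr_ge0; first lra.
    by rewrite -addrA; do 2?apply: addr_ge0; rewrite !mulr_ge0 //; lra.
  nra.
pose F := (a + b) / 2 - g - h.
have d1 : 0 <= (F - f) * (a * (F + f) + 2 * g * h).
  apply: mulr_ge0; first by rewrite /F; lra.
  by apply: addr_ge0; rewrite !mulr_ge0 // /F; lra.
have d2 : 0 <= (b - F) * ((a - 2 * g) * (a - 2 * h)).
  by rewrite !mulr_ge0 // /F; lra.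
have d3 : 0 <= (a + b) * (a - (g + h)) * (2 * (g + h) - a).
  by rewrite !mulr_ge0 // /F; lra.
have d4 : 0 <= a * (b - a) * b by rewrite !mulr_ge0 // /F; lra.
have d5 : 0 <= a * (b - a) * (a - (g + h)) by rewrite !mulr_ge0 // /F; lra.
rewrite /F in d1 d2; nra.
Qed.

(** Only the squares of [f], [g], [h] and the sign of their product enter the determinant, so two
    sign patterns suffice. *)
Lemma sorted_det3_ge (R : realFieldType) (a b c f g h : R) : 0 < a -> a <= b ->
  b <= c ->
  2 * `|g| <= a -> 2 * `|h| <= a -> 2 * `|f| <= b ->
  (f * g * h < 0 -> 2 * (`|f| + `|g| + `|h|) <= a + b) ->
  a * b * c <= 2 * det3 a b c f g h.
Proof.
move=> a0 ab bc ga ha fb obt.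
have absE : `|f| * `|g| * `|h| = `|f * g * h| by rewrite !normrM.
have sqE (x : R) : `|x| ^+ 2 = x ^+ 2 by rewrite real_normK ?num_real.
have [fgh|fgh] := ltP (f * g * h) 0.
  have -> : det3 a b c f g h = det3 a b c `|f| `|g| (- `|h|).
    rewrite (ltr0_norm fgh) in absE.
    by rewrite /det3 sqrrN !sqE; congr (_ + _ - _ - _ - _); lra.
  exact: obtuse_det3_ge (obt fgh).
have -> : det3 a b c f g h = det3 a b c `|f| `|g| `|h|.
  rewrite (ger0_norm fgh) in absE.
  by rewrite /det3 !sqE; congr (_ + _ - _ - _ - _); lra.
exact: acute_det3_ge.
Qed.

(** The hypotheses are invariant under permutations of the basis, so the diagonal may be sorted. *)
Lemma reduced_det3_ge (R : realFieldType) (m a b c f g h : R) : 0 < m ->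
  m <= a -> m <= b -> m <= c ->
  2 * `|f| <= b -> 2 * `|f| <= c -> 2 * `|g| <= a -> 2 * `|g| <= c ->
  2 * `|h| <= a -> 2 * `|h| <= b ->
  (f * g * h < 0 -> 2 * (`|f| + `|g| + `|h|) <= a + b /\
    2 * (`|f| + `|g| + `|h|) <= a + c /\ 2 * (`|f| + `|g| + `|h|) <= b + c) ->
  m ^+ 3 <= 2 * det3 a b c f g h.
Proof.
move=> m0 ma mb mc fb fc ga gc ha hb obt.
have m3 : m ^+ 3 <= a * b * c.
  by rewrite exprSr expr2 !ler_pM ?mulr_ge0 //; lra.
apply: le_trans m3 _.
wlog ab : a b f g ma mb fb fc ga gc ha hb obt / a <= b.
  move=> W; have [ab|/ltW ba] := leP a b; first exact: W.
  have -> : det3 a b c f g h = det3 b a c g f h by rewrite /det3; ring.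
  rewrite [a * b]mulrC; apply: W => //; rewrite ![g * f]mulrC =>
    /obt [] o1 [] o2 o3; lra.
wlog bc : b c g h mb mc fb fc ga gc ha hb obt ab / b <= c.
  move=> W; have [bc|/ltW cb] := leP b c; first exact: W.
  have [ac|/ltW ca] := leP a c.
    have -> : det3 a b c f g h = det3 a c b f h g by rewrite /det3; ring.
    rewrite -mulrA [b * c]mulrC mulrA; apply: W => //.
    rewrite -mulrA [h * g]mulrC mulrA => /obt [] o1 [] o2 o3; lra.
  (* Here [c <= a <= b]. As [W] keeps [a] in first place, the cyclic permutation is treated
     directly. *)
  have -> : det3 a b c f g h = det3 c a b h f g by rewrite /det3; ring.
  rewrite [_ * c]mulrC mulrA; apply: sorted_det3_ge => //; first lra.
  rewrite (_ : h * f * g = f * g * h); last by ring.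
  move=> /obt [] o1 [] o2 o3; lra.
apply: sorted_det3_ge => //; first lra.
by move=> /obt [].
Qed.

(** * Lattice bases of minimal total squared length *)

Definition gram (R : comNzRingType) (m n : nat) (B : 'M[R]_(m, n)) :
  'M[R]_m := B *m B^T.

Lemma gramE (R : comNzRingType) (m n : nat) (B : 'M[R]_(m, n)) i : gram B i i =
  \sum_k B i k ^+ 2.
Proof. by rewrite mxE; apply: eq_bigr => k _; rewrite mxE expr2. Qed.

(** Since [x = (x *m B) *m invmx B], a coordinate of [x] is bounded by the largest one of [x *m B]
    times [T], the sum of the absolute values of the entries of [invmx B]. *)
Lemma norm_row_coercive (R : realFieldType) (n : nat) (B : 'M[R]_n) :
  B \in unitmx ->
  exists2 c, 0 < c & forall (x : 'rV[R]_n) j, c * x 0 j ^+ 2 <=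
    \sum_k (x *m B) 0 k ^+ 2.
Proof.
move=> uB; pose T := \sum_i \sum_j `|invmx B i j|.
have T0 : 0 <= T by do 2![apply: sumr_ge0 => ? _].
have T1 : 0 < T ^+ 2 + 1 by rewrite ltr_wpDl ?exprn_ge0.
exists (T ^+ 2 + 1)^-1; first by rewrite invr_gt0.
move=> x j; rewrite mulrC ler_pdivrMr //.
set y := x *m B; set S := \sum_k _.
have S0 : 0 <= S by apply: sumr_ge0 => k _; apply: sqr_ge0.
have bnd : x 0 j ^+ 2 <= (\sum_k `|y 0 k| * `|invmx B k j|) ^+ 2.
  rewrite -[x](mulmxK uB) -/y mxE -real_normK ?num_real // lerXn2r ?nnegrE //.
    by apply: sumr_ge0 => k _; apply: mulr_ge0.
  by apply: le_trans (ler_norm_sum _ _ _) _; apply: ler_sum => k _; rewrite normrM.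
have [k0 yk0] : exists k0, forall k, `|y 0 k| <= `|y 0 k0|.
  exists [arg max_(k > j) `|y 0 k|]%O; case: Order.TotalTheory.arg_maxP => //
    k0 _ H k.
  exact: H.
have yS : `|y 0 k0| ^+ 2 <= S.
  by rewrite real_normK ?num_real // /S (bigD1 k0) //= lerDl;
    apply: sumr_ge0 => k _; apply: sqr_ge0.
have bnd2 : \sum_k `|y 0 k| * `|invmx B k j| <= `|y 0 k0| * T.
  rewrite mulr_sumr; apply: ler_sum => k _; apply: ler_pM => //.
  by rewrite (bigD1 j) //= lerDl; apply: sumr_ge0.
apply: le_trans bnd _.
apply: (@le_trans _ _ ((`|y 0 k0| * T) ^+ 2)).
  rewrite lerXn2r ?nnegrE ?mulr_ge0 //.
  by apply: sumr_ge0 => k _; apply: mulr_ge0.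
rewrite exprMn mulrDr mulr1 ler_wpDr // ler_wpM2r ?exprn_ge0 //.
Qed.

Section Min.
Variables (R : archiRealFieldType) (n m : nat) (B : 'M[R]_(n, m)) (c : R).
Hypothesis c_gt0 : 0 < c.
Hypothesis coercB : forall (x : 'rV[R]_n) j, c * x 0 j ^+ 2 <=
  \sum_k (x *m B) 0 k ^+ 2.
Notation F V := (\tr (gram (map_mx (intr : int -> R) V *m B))).

Lemma entry_le (V : 'M[int]_n) i j : c * (V i j)%:~R ^+ 2 <= F V.
Proof.
have ge0 k : 0 <= gram (map_mx (intr : int -> R) V *m B) k k.
  by rewrite gramE; apply: sumr_ge0 => l _; apply: sqr_ge0.
rewrite /mxtrace (bigD1 i) //= -[leLHS]addr0 lerD //; last by apply: sumr_ge0.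
have := coercB (row i (map_mx intr V)) j; rewrite [X in c * X ^+ 2]mxE [X in c * X
  ^+ 2]mxE => /le_trans; apply.
by rewrite -row_mul gramE; apply: ler_sum => k _; rewrite [X in X ^+ 2]mxE.
Qed.

(** By coercivity only finitely many integer matrices do at least as well as the identity, and the
    minimum is attained among them. *)
Lemma exists_min_trace :
  exists2 U : 'M[int]_n, U \in unitmx & forall V : 'M[int]_n, V \in unitmx ->
    F U <= F V.
Proof.
pose N := Num.bound (F (1%:M : 'M[int]_n) / c).
have entryN (V : 'M[int]_n) i j : F V <= F 1%:M -> `|V i j| <= N%:Z.
  move=> FV; rewrite leNgt; apply/negP => ltN.
  have := entry_le V i j; rewrite -ler_pdivlMl // => VF.
  have /(le_lt_trans VF) : c^-1 * F V < N%:R.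
    apply: le_lt_trans (archi_boundP _); first by rewrite mulrC ler_pM2r ?invr_gt0.
    rewrite divr_ge0 ?(ltW c_gt0) // sumr_ge0 // => k _.
    by rewrite gramE; apply: sumr_ge0 => l _; apply: sqr_ge0.
  rewrite -rmorphXn /= [N%:R](_ : _ = N%:Z%:~R) // ltr_int => VN.
  have : `|V i j| <= V i j ^+ 2.
    rewrite -[V i j ^+ 2]real_normK ?num_real // expr2 ler_peMl //.
    by rewrite -gtz0_ge1 (le_lt_trans _ ltN).
  by move=> /le_lt_trans /(_ VN) /(lt_trans ltN); rewrite ltxx.
(* Entries in the interval from [- N] to [N] are coded by [2 N + 1] ordinals, shifted by [N]. *)
pose dec (W : 'M['I_(N.*2.+1)]_n) : 'M[int]_n := \matrix_(i, j) ((W i j :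
  nat)%:Z - N%:Z).
have decP (V : 'M[int]_n) : F V <= F 1%:M -> exists W, V = dec W.
  move=> FV; exists (\matrix_(i, j) inord (absz (V i j + N%:Z))).
  apply/matrixP => i j; rewrite !mxE.
  have := entryN V i j FV; rewrite ler_norml => /andP[l1 l2].
  have VN0 : 0 <= V i j + N%:Z by rewrite -lerBlDr sub0r.
  rewrite inordK; first by rewrite gez0_abs // addrK.
  by rewrite ltnS -lez_nat gez0_abs // -addnn PoszD lerD2r.
have [W0 W0E] := decP _ (lexx _).
pose P (W : 'M['I_(N.*2.+1)]_n) := dec W \in unitmx.
have PW0 : P W0 by rewrite /P -W0E unitmx1.
case: (Order.TotalTheory.arg_minP (fun W => F (dec W)) PW0) => W PW minW.
exists (dec W) => // V uV.
have [/decP[W' VE]|/ltW FV] := leP (F V) (F 1%:M).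
  by rewrite VE; apply: minW; rewrite /P -VE.
by apply: le_trans FV; rewrite W0E; apply: minW.
Qed.
End Min.

(** * Gauss' inequality for lattices of rank 3 *)

Lemma det_mx33 (R : comNzRingType) (A : 'M[R]_3) (i j k : 'I_3) :
  i = 0%N :> nat -> j = 1%N :> nat -> k = 2%N :> nat ->
  \det A = A i i * (A j j * A k k - A j k * A k j)
         - A i j * (A j i * A k k - A j k * A k i)
         + A i k * (A j i * A k j - A j j * A k i).
Proof.
move=> i0 j1 k2.
pose f p q := A (inord p) (inord q).
have -> : A = \matrix_(p < 3, q < 3) f p q.
  by apply/matrixP => p q; rewrite mxE /f !inord_val.
rewrite (expand_det_row _ ord0) !big_ord_recl big_ord0 /cofactor.
rewrite !(expand_det_row _ ord0) !big_ord_recl !big_ord0 /cofactor !det_mx11.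
rewrite !mxE /= i0 j1 k2 /=.
rewrite !/bump /= !(addn0, add0n, add1n) expr0 expr1.
ring.
Qed.

Lemma gram_cross (R : comNzRingType) (n m : nat) (C : 'M[R]_(n, m)) (i j k :
  'I_n) (s t : R) :
  \sum_l (C i l + (s * C j l + t * C k l)) ^+ 2 =
  gram C i i + 2 * s * gram C i j + 2 * t * gram C i k
   + s ^+ 2 * gram C j j + t ^+ 2 * gram C k k + 2 * s * t * gram C j k.
Proof.
rewrite !mxE !mulr_sumr -!big_split /=; apply: eq_bigr => l _; rewrite !mxE; ring.
Qed.

(** Adding to row [i] the combination [v] of the other rows changes a single diagonal entry of the
    Gram matrix. It is unimodular: as [v 0 i = 0], the matrix [delta_mx i 0 *m v] has square 0. *)
Lemma trace_min_row (R : realFieldType) (n m : nat) (C : 'M[R]_(n, m)) :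
  (forall W : 'M[int]_n, W \in unitmx ->
     \tr (gram C) <= \tr (gram (map_mx (intr : int -> R) W *m C))) ->
  forall (i : 'I_n) (v : 'rV[int]_n), v 0 i = 0 ->
  gram C i i <= \sum_l (C i l + (map_mx intr v *m C) 0 l) ^+ 2.
Proof.
move=> minC i v vi.
pose W : 'M[int]_n := 1%:M + delta_mx i 0 *m v.
have uW : W \in unitmx.
  suff : W *m (1%:M - delta_mx i 0 *m v) = 1%:M by move=> /mulmx1_unit[].
  have v0 : v *m delta_mx i 0 = 0 :> 'M[int]_1.
    by rewrite -colE; apply/matrixP => p q; rewrite !mxE !ord1.
  rewrite mulmxDl mul1mx mulmxBr mulmx1 -mulmxA [v *m _]mulmxA v0.
  by rewrite mul0mx mulmx0 subr0 subrK.
have := minC W uW.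
have WE p l : (map_mx (intr : int -> R) W *m C) p l =
    C p l + (p == i)%:R * (map_mx intr v *m C) 0 l.
  rewrite map_mxD map_mx1 mulmxDl mul1mx map_mxM map_delta_mx -mulmxA.
  by rewrite [LHS]mxE; congr (_ + _); rewrite mxE big_ord1 !mxE eqxx andbT.
rewrite /mxtrace (bigD1 i) //= [X in _ <= X](bigD1 i) //=.
rewrite [X in _ <= _ + X -> _](eq_bigr (fun k => gram C k k)); last first.
  move=> k /negbTE ki; rewrite !gramE; apply: eq_bigr => l _.
  by rewrite WE ki mul0r addr0.
rewrite lerD2r => /le_trans; apply; rewrite gramE; apply: ler_sum => l _.
by rewrite WE eqxx mul1r.
Qed.

(** The case of [trace_min_row] where [v] has coefficients [s] and [t] at [j] and [k], expanded by
    [gram_cross]. *)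
Lemma min_trace_pair (R : realFieldType) (n m : nat) (C : 'M[R]_(n, m)) :
  (forall W : 'M[int]_n, W \in unitmx ->
     \tr (gram C) <= \tr (gram (map_mx (intr : int -> R) W *m C))) ->
  forall (i j k : 'I_n) (s t : int), i != j -> i != k ->
  0 <= 2 * s%:~R * gram C i j + 2 * t%:~R * gram C i k
   + s%:~R ^+ 2 * gram C j j + t%:~R ^+ 2 * gram C k k + 2 * s%:~R * t%:~R * gram C
     j k.
Proof.
move=> minC i j k s t ij ik.
pose v : 'rV[int]_n := s *: delta_mx 0 j + t *: delta_mx 0 k.
have vi : v 0 i = 0 by rewrite !mxE !eqxx (negbTE ij) (negbTE ik) /= !mulr0.
have vC l : (map_mx intr v *m C) 0 l = s%:~R * C j l + t%:~R * C k l.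
  by rewrite map_mxD !map_mxZ !map_delta_mx mulmxDl -!scalemxAl -!rowE !mxE.
have := trace_min_row minC vi.
rewrite (eq_bigr _ (fun l _ => congr1 (fun x =>
  (C i l + x) ^+ 2) (vC l))) gram_cross.
by rewrite -!addrA lerDl.
Qed.

(** Choose [s] and [t] to make [s h] and [t g] nonpositive; the product of [s t f], [t g] and [s h]
    is [f g h], which decides the sign of [s t f]. *)
Lemma sign_choice (R : realDomainType) (f g h : R) : f * g * h < 0 ->
  exists s t : int, [/\ s ^+ 2 = 1, t ^+ 2 = 1, `|h| = - (s%:~R * h), `|g| =
    - (t%:~R * g)
    & `|f| = - (s%:~R * t%:~R * f)].
Proof.
have sgn (x : R) : exists2 s : int, s ^+ 2 = 1 & `|x| = - (s%:~R * x).
  have [x0|x0] := leP 0 x; first by exists (-1) => //;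
    rewrite mulN1r opprK ger0_norm.
  by exists 1 => //; rewrite mul1r ltr0_norm.
move=> fgh; have [s s1 hE] := sgn h; have [t t1 gE] := sgn g.
exists s, t; split => //; rewrite -ltr0_norm.
  rewrite !normrM -!intr_norm.
  have norm1 (x : int) : x ^+ 2 = 1 -> `|x| = 1.
    by move=> /eqP; rewrite sqrf_eq1 => /orP[] /eqP ->.
  by rewrite !norm1 // !mul1r.
have gh : 0 < `|g| * `|h|.
  rewrite -normrM normr_gt0; apply/eqP => gh0.
  by move: fgh; rewrite -mulrA gh0 mulr0 ltxx.
rewrite -(pmulr_llt0 _ gh) gE hE mulrNN.
have E : (s%:~R ^+ 2 = 1 :> R) /\ (t%:~R ^+ 2 = 1 :> R)
  by rewrite -!rmorphXn /= s1 t1.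
have -> (x y : R) : x * y * f * (y * g * (x * h)) = x ^+ 2 * y ^+ 2 * (f * g * h).
  by ring.
by rewrite E.1 E.2 !mul1r.
Qed.

(** The number of columns is free because the lattice will be a section of one of rank 4. Rows of
    unimodular transforms of [B] are the primitive vectors of its lattice. *)
Theorem ternary_min_det (R : archiRealFieldType) (n : nat) (B : 'M[R]_(3,
  n)) (c m : R) :
  0 < c -> (forall (x : 'rV[R]_3) j, c * x 0 j ^+ 2 <= \sum_k (x *m B) 0 k ^+ 2) ->
  0 < m -> (forall (U : 'M[int]_3) i, U \in unitmx ->
    m <= gram (map_mx intr U *m B) i i) ->
  m ^+ 3 <= 2 * \det (gram B).
Proof.
move=> c0 coercB m0 mB.
have [U uU minU] := exists_min_trace c0 coercB.
set C := map_mx intr U *m B in minU.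
have minC (W : 'M[int]_3) : W \in unitmx ->
     \tr (gram C) <= \tr (gram (map_mx (intr : int -> R) W *m C)).
  by move=> uW; rewrite /C mulmxA -map_mxM; apply: minU; rewrite unitmx_mul uW.
have -> : \det (gram B) = \det (gram C).
  rewrite /gram /C trmx_mul mulmxA -(mulmxA _ B) !det_mulmx det_tr mulrC mulrA.
  rewrite -expr2 det_map_mx -rmorphXn /=.
  have : \det U \is a GRing.unit by [].
  by case/orP => /eqP ->; rewrite ?sqrrN expr1n mul1r.
have sym i j : gram C i j = gram C j i by rewrite !mxE; apply: eq_bigr => k _;
  rewrite !mxE mulrC.
pose i0 : 'I_3 := ord0; pose i1 : 'I_3 := Ordinal (isT : 1 < 3)%N;
  pose i2 : 'I_3 := ord_max.
rewrite (@det_mx33 _ _ i0 i1 i2) //.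
rewrite (sym i1 i0) (sym i2 i0) (sym i2 i1).
set a := gram C i0 i0; set b := gram C i1 i1; set d := gram C i2 i2.
set f := gram C i1 i2; set g := gram C i0 i2; set h := gram C i0 i1.
have -> : a * (b * d - f * f) - h * (h * d - f * g) + g * (h * f - b * g) =
  det3 a b d f g h.
  by rewrite /det3; ring.
pose P := min_trace_pair minC.
have Q (i j : 'I_3) : i != j -> 2 * `|gram C i j| <= gram C j j.
  move=> ij; have := P i j j 1 0 ij ij; have := P i j j (-1) 0 ij ij.
  rewrite !mulr0z !rmorphN /= => ? ?; rewrite -ler_pdivlMl // ler_norml;
    apply/andP; split; lra.
have hQ : 2 * `|h| <= a by rewrite /h sym; apply: Q.
have gQ : 2 * `|g| <= a by rewrite /g sym; apply: Q.
have fQ : 2 * `|f| <= b by rewrite /f sym; apply: Q.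
apply: (@reduced_det3_ge _ _ a b d f g h) => //; try exact: mB; try exact: Q.
move=> fgh; have [s [t [s1 t1 hE gE fE]]] := sign_choice fgh.
have sR : s%:~R ^+ 2 = 1 :> R by rewrite -rmorphXn /= s1.
have tR : t%:~R ^+ 2 = 1 :> R by rewrite -rmorphXn /= t1.
(* With [e0], [e1], [e2] the rows of [C], the vector [e0 + s e1 + t e2] replaces, up to sign, each
   of them in turn. *)
have P0 := P i0 i1 i2 s t isT isT.
have P1 := P i1 i0 i2 s (s * t) isT isT.
have P2 := P i2 i0 i1 t (s * t) isT isT.
rewrite !(sym i1 i0) -/a -/b -/d -/f -/g -/h !rmorphM /= in P0 P1 P2.
rewrite !(sym i2 i0) !(sym i2 i1) -/f -/g in P1 P2.
rewrite hE gE fE; set x : R := s%:~R; set y : R := t%:~R.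
rewrite -/x -/y in sR tR P0 P1 P2; move: x y sR tR P0 P1 P2 => x y x2 y2 P0 P1 P2.
have xxy z : 2 * x * (x * y) * z = 2 * y * z by rewrite -[RHS]mul1r -x2; ring.
have yxy z : 2 * y * (x * y) * z = 2 * x * z by rewrite -[RHS]mul1r -y2; ring.
rewrite exprMn x2 y2 ?xxy ?yxy in P0 P1 P2.
do ?split; lra.
Qed.

(** * Dual lattices and Mordell's inequality in dimension 4 *)

Lemma det_gram (R : comNzRingType) (n : nat) (B : 'M[R]_n) : \det (gram B) =
  \det B ^+ 2.
Proof. by rewrite det_mulmx det_tr expr2. Qed.

(* [dsubmx B] is a basis of the section of the lattice orthogonal to the first
   vector of the dual basis [(invmx B)^T]. *)
Lemma det_gram_dual (R : fieldType) (n : nat) (B : 'M[R]_(1 + n)) : B \in unitmx ->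
  \det (gram (dsubmx B)) = gram (invmx B)^T 0 0 * \det B ^+ 2.
Proof.
move=> uB; set K := gram (invmx B)^T.
have KG : K *m gram B = 1%:M.
  by rewrite /K /gram trmxK mulmxA mulmxKV // -trmx_mul mulmxV // trmx1.
have GE : gram B = block_mx (gram (usubmx B)) (usubmx B *m (dsubmx B)^T)
    (dsubmx B *m (usubmx B)^T) (gram (dsubmx B)).
  by rewrite /gram -{1 2}[B]vsubmxK tr_col_mx mul_col_row.
(* As in Cramer's rule: [L] is the identity with its first row replaced by that of [K], the inverse
   of [gram B], so that [L] and [L *m gram B] are both block triangular. *)
pose L : 'M[R]_(1 + n) := block_mx (ulsubmx K) (ursubmx K) 0 1%:M.
have LG : L *m gram B = block_mx 1%:M 0 (dsubmx B *m (usubmx B)^T) (gram (dsubmx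
  B)).
  move: KG; rewrite GE -{1}[K]submxK /L !mulmx_block (scalar_mx_block 1 n).
  by case/eq_block_mx => -> -> _ _; rewrite !mul0mx !mul1mx !add0r.
have := congr1 determinant LG.
rewrite det_mulmx det_lblock det_ublock !det1 mul1r mulr1 det_mx11 det_gram => <-.
by congr (_ * _); rewrite [LHS]mxE [LHS]mxE; congr (K _ _); apply: val_inj.
Qed.

(** A unimodular change of basis of the section extends by 1 to the whole lattice, so the section
    inherits the bound [m] and [ternary_min_det] applies to it. *)
Lemma mordell_dual_row0 (R : archiRealFieldType) (B : 'M[R]_(1 + 3)) (m : R) :
  B \in unitmx -> 0 < m ->
  (forall (U : 'M[int]_(1 + 3)) i, U \in unitmx ->
    m <= gram (map_mx intr U *m B) i i) ->
  m ^+ 3 <= 2 * (gram (invmx B)^T 0 0 * \det B ^+ 2).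
Proof.
move=> uB m0 mB; rewrite -det_gram_dual //.
have [c c0 coercB] := norm_row_coercive uB.
apply: (ternary_min_det c0) => // [x j|U i uU].
  have := coercB (row_mx 0 x) (rshift 1 j).
  by rewrite row_mxEr -{1}[B]vsubmxK mul_row_col mul0mx add0r.
have := mB (block_mx 1%:M 0 0 U) (rshift 1 i).
rewrite unitmxE det_ublock det1 mul1r -unitmxE => /(_ uU).
rewrite map_block_mx map_mx1 !map_mx0 -{1}[B]vsubmxK mul_block_col !mul0mx mul1mx
  add0r addr0.
rewrite !gramE; under eq_bigr do rewrite col_mxEd.
by [].
Qed.

Lemma mordell_dual_bound (R : archiRealFieldType) (B : 'M[R]_(1 + 3)) (m : R) :
  B \in unitmx -> 0 < m ->
  (forall (U : 'M[int]_(1 + 3)) i, U \in unitmx ->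
    m <= gram (map_mx intr U *m B) i i) ->
  forall (U : 'M[int]_(1 + 3)) i, U \in unitmx ->
  m ^+ 3 <= 2 * (gram (map_mx intr U *m (invmx B)^T) i i * \det B ^+ 2).
Proof.
move=> uB m0 mB U i uU.
(* Dual bases change by the inverse transpose: that of [V *m B] starts with row [i] of [U] times the
   dual basis of [B]. *)
pose V : 'M[int]_(1 + 3) := invmx (perm_mx (perm.tperm 0 i) *m U)^T.
have uV : V \in unitmx by rewrite unitmx_inv unitmx_tr unitmx_mul unitmx_perm.
have uVR : map_mx (intr : int -> R) V \in unitmx.
  rewrite unitmxE det_map_mx; apply: rmorph_unit; by rewrite -unitmxE.
have := @mordell_dual_row0 _ (map_mx intr V *m B) m;
  rewrite unitmx_mul uVR uB => /(_ isT m0).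
have -> : \det (map_mx intr V *m B) ^+ 2 = \det B ^+ 2.
  rewrite det_mulmx exprMn det_map_mx -rmorphXn /=.
  have : \det V \is a GRing.unit by [].
  by case/orP => /eqP ->; rewrite ?sqrrN expr1n mul1r.
have -> : gram (invmx (map_mx intr V *m B))^T 0 0 =
  gram (map_mx intr U *m (invmx B)^T) i i.
  have -> : invmx (map_mx intr V *m B) = invmx B *m (map_mx intr (perm_mx
    (perm.tperm 0 i) *m U))^T.
    have uX : map_mx intr V *m B \in unitmx by rewrite unitmx_mul uVR.
    rewrite -[RHS](mulKmx uX) -[LHS]mulmx1; congr (_ *m _).
    rewrite -mulmxA mulKVmx //.
    by rewrite map_trmx -map_mxM mulVmx ?map_mx1 //
      unitmx_tr unitmx_mul unitmx_perm.
  rewrite trmx_mul trmxK map_mxM -mulmxA map_perm_mx -row_permE !gramE.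
  by apply: eq_bigr => k _; rewrite mxE perm.tpermL.
apply=> W j uW; rewrite mulmxA -map_mxM; apply: mB; by rewrite unitmx_mul uW.
Qed.

Theorem quaternary_min_det (R : realType) (B : 'M[R]_(1 + 3)) (m : R) :
  B \in unitmx -> 0 < m ->
  (forall (U : 'M[int]_(1 + 3)) i, U \in unitmx ->
    m <= gram (map_mx intr U *m B) i i) ->
  m ^+ 4 <= 4 * \det B ^+ 2.
Proof.
move=> uB m0 mB; set D := \det B ^+ 2.
have D0 : 0 < D by move: uB; rewrite exprn_even_gt0 // unitmxE unitfE.
have detC : \det (invmx B)^T ^+ 2 = D^-1 by rewrite det_tr det_inv exprVn.
have boundC x := @mordell_dual_bound _ B x uB; rewrite -/D in boundC.
move: D => D in D0 detC boundC *.
pose A := [set x | exists (U : 'M[int]_(1 + 3)) i, U \in unitmx /\ x =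
  gram (map_mx (intr : int -> R) U *m B) i i].
have A_neq0 : A !=set0 by exists (gram (map_mx intr (1%:M :
  'M[int]_(1 + 3)) *m B) 0 0), 1%:M, 0; rewrite unitmx1.
(* The given [m] is only a lower bound. With the infimum [a] in its place, the lower bound found by
   dualizing twice is itself at most [a]. *)
have lbA : lbound A m by move=> _ [U [i [uU ->]]]; exact: mB.
have mA : m <= inf A by apply: lb_le_inf.
have hA : has_lbound A by exists m.
set a := inf A in mA.
have aB (U : 'M[int]_(1 + 3)) i : U \in unitmx ->
  a <= gram (map_mx intr U *m B) i i.
  by move=> uU; apply: ge_inf => //; exists U, i.
have a0 : 0 < a by exact: lt_le_trans mA.
pose b := a ^+ 3 / (2 * D).
have D2 : 0 < 2 * D by exact: mulr_gt0.
have b0 : 0 < b by apply: divr_gt0 => //; exact: exprn_gt0.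
have bC (U : 'M[int]_(1 + 3)) i : U \in unitmx ->
  b <= gram (map_mx intr U *m (invmx B)^T) i i.
  move=> uU; rewrite ler_pdivrMr //.
  by have := boundC _ a0 aB U i uU; lra.
have uC : (invmx B)^T \in unitmx by rewrite unitmx_tr unitmx_inv.
have ba : b ^+ 3 * D / 2 <= a.
  apply: lb_le_inf => // _ [U [i [uU ->]]].
  have := mordell_dual_bound uC b0 bC i uU.
  rewrite detC trmx_inv trmxK invmxK.
  rewrite ler_pdivrMr // mulrA ler_pdivlMr //; lra.
have a8 : a ^+ 8 <= 16 * D ^+ 2.
  rewrite -(ler_pM2l a0) -exprS.
  have -> : a ^+ 9 = (b ^+ 3 * D / 2) * (16 * D ^+ 2).
    by rewrite /b; field; rewrite gt_eqF.
  rewrite ler_pM2r //; apply: mulr_gt0 => //; exact: exprn_gt0.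
have a4 : a ^+ 4 <= 4 * D.
  rewrite -(@ler_pXn2r _ 2) ?nnegrE ?exprn_ge0 ?(ltW a0) ?mulr_ge0 ?(ltW D0) //.
  by rewrite -exprM; apply: le_trans a8 _; rewrite le_eqVlt; apply/orP; left;
    apply/eqP; ring.
by apply: le_trans a4; rewrite lerXn2r // nnegrE ltW.
Qed.

(** * Balls of radius 2 and interiors *)

Definition sqnorm (R : realType) (n : nat) (x : 'rV[R]_n) : R := \sum_i x 0 i ^+ 2.

Lemma sqnorm_ge0 (R : realType) (n : nat) (x : 'rV[R]_n) : 0 <= sqnorm x.
Proof. by apply: sumr_ge0 => i _; apply: sqr_ge0. Qed.

Lemma sqnormZ (R : realType) (n : nat) (a : R) (x : 'rV[R]_n) : sqnorm (a *: x) =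
  a ^+ 2 * sqnorm x.
Proof. by rewrite /sqnorm mulr_sumr; apply: eq_bigr => i _; rewrite mxE exprMn. Qed.

Lemma sqnorm_eq0 (R : realType) (n : nat) (x : 'rV[R]_n) : (sqnorm x == 0) =
  (x == 0).
Proof.
apply/eqP/eqP => [x0|->]; last by apply: big1 => i _; rewrite mxE expr0n.
apply/rowP => i; rewrite mxE; apply/eqP; rewrite -sqrf_eq0; apply/eqP.
by apply: (psumr_eq0P _ x0) => // j _; apply: sqr_ge0.
Qed.

Lemma double_ballE (R : realType) (n : nat) (x : 'rV[R]_n) :
  [set 2 *: y | y in @unit_ball R n] x <-> sqnorm x <= 4.
Proof.
have ballE (y : 'rV[R]_n) : unit_ball y <-> sqnorm y <= 1.
  by rewrite /unit_ball /= /euclidean_norm -{1}sqrtr1 ler_sqrt.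
split=> [[y /ballE y1 <-]|x4]; first by rewrite sqnormZ; lra.
exists (2^-1 *: x); last by rewrite scalerA divff ?scale1r.
apply/ballE; rewrite sqnormZ; lra.
Qed.

Lemma sqnorm_continuous (R : realType) (n : nat) : continuous (@sqnorm R n).
Proof.
move=> x; apply: (@cvg_big _ _ _ _ _ (@add_continuous R) _ (nbhs x) _ (fun i (y :
  'rV[R]_n) => y 0 i ^+ 2) (fun i => x 0 i ^+ 2) (nbhs_filter x)) => i _.
apply: (@continuous_comp _ _ _ (fun y : 'rV[R]_n => y 0 i) (fun t => t ^+ 2) x);
  last exact: exprn_continuous.
exact: coord_continuous.
Qed.

Lemma double_ball_interior (R : realType) (n : nat) (x : 'rV[R]_n) :
  sqnorm x < 4 -> ([set 2 *: y | y in @unit_ball R n])° x.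
Proof.
move=> x4; have : \forall y \near x, sqnorm y < 4.
  exact: (sqnorm_continuous (lt_nbhsl x4)).
by apply: filterS => y y4; apply/double_ballE/ltW.
Qed.

(** By continuity of scaling at 1. This turns [<= 4] on a ball into [< 4] on its interior, and
    likewise for the product of two balls. *)
Lemma interior_dilate (R : realType) (n : nat) (T : set 'rV[R]_n) (x : 'rV[R]_n) :
  T° x -> exists2 a : R, 1 < a & T (a *: x).
Proof.
move=> Tx.
have cx : (fun a : R => a *: x) @ (1 : R) --> 1 *: x by exact: scalel_continuous.
have nT : nbhs (1 *: x) T by rewrite scale1r.
have : \forall a \near 1^'+, T (a *: x).
  apply: cvg_within; exact: (cx _ nT).
move=> H; have [a [a1 aT]] : exists a, 1 < a /\ T (a *: x).
  near (1 : R)^'+ => a; exists a; split; near: a => //.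
  exact: nbhs_right_gt.
by exists a.
Unshelve. all: by end_near.
Qed.

(** * Admissible lattices in terms of bases *)

Lemma unit_row_neq0 (R : comUnitRingType) (n : nat) (M : 'M[R]_n) i :
  M \in unitmx -> row i M != 0.
Proof.
move=> uM; apply/eqP => r0.
have /rowP/(_ i) : row i (1%:M : 'M[R]_n) = 0
  by rewrite -(mulmxV uM) row_mul r0 mul0mx.
by rewrite !mxE eqxx => /eqP; rewrite oner_eq0.
Qed.

Lemma comb_eq0 (R : realType) (n : nat) (B : 'M[R]_n) (z : 'rV[int]_n) :
  B \in unitmx -> map_mx intr z *m B = 0 -> z = 0.
Proof.
move=> uB zB; have /rowP z0 : map_mx intr z = 0 :> 'rV[R]_n.
  by rewrite -[LHS](mulmxK uB) zB mul0mx.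
by apply/rowP => i; have := z0 i; rewrite !mxE => /eqP; rewrite intr_eq0 => /eqP.
Qed.

Lemma basis_mem_critical_set (R : realType) (n : nat) (T : set 'rV[R]_n) (B :
  'M[R]_n) :
  B \in unitmx ->
  (forall z : 'rV[int]_n, T° (map_mx intr z *m B) -> z = 0) ->
  [set covol L | L in [set L : set 'rV[R]_n |
    full_rank_lattice L /\ (L `\ 0) `&` T° = set0]] `|\det B|.
Proof.
move=> uB BT; pose L := [set map_mx intr z *m B | z in [set: 'rV[int]_n]].
have LB : lattice_basis L B by [].
exists L; last exact: covolE.
split; first by exists B.
rewrite -subset0 => x [[[z _ <-] /= z0] /BT zE]; apply: z0.
by rewrite zE map_mx0 mul0mx.
Qed.

Lemma critical_determinant_le (R : realType) (n : nat) (T : set 'rV[R]_n) (B :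
  'M[R]_n) :
  B \in unitmx ->
  (forall z : 'rV[int]_n, T° (map_mx intr z *m B) -> z = 0) ->
  critical_determinant T <= `|\det B|.
Proof.
move=> uB BT; apply: ge_inf; last exact: basis_mem_critical_set.
by exists 0 => _ [L _ <-]; apply: normr_ge0.
Qed.

(** * The critical determinant of the ball of radius 2 in dimension 4 *)

Section Ball.
Variable R : realType.
Notation S := [set 2 *: x | x in @unit_ball R 4].

Lemma interior_double_ball (x : 'rV[R]_4) : S° x -> sqnorm x < 4.
Proof.
move=> /interior_dilate [a a1 /double_ballE]; rewrite sqnormZ => ax.
have a2 : 1 < a ^+ 2 by rewrite expr_gt1 // ltW // (lt_trans ltr01).
have [x0|x0] := leP (sqnorm x) 0; first by rewrite (le_lt_trans x0).
by rewrite (lt_le_trans _ ax) // ltr_pMl.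
Qed.

(** Nonzero lattice vectors have squared norm at least 4, and [quaternary_min_det] with [m = 4]
    reads [4 ^+ 4 <= 4 * \det B ^+ 2]. *)
Lemma ball_lattice_det_ge (B : 'M[R]_4) : B \in unitmx ->
  (forall z : 'rV[int]_4, S° (map_mx intr z *m B) -> z = 0) -> 8 <= `|\det B|.
Proof.
move=> uB BS.
have : 4 ^+ 4 <= 4 * \det B ^+ 2.
  apply: quaternary_min_det => // U i uU; rewrite leNgt; apply/negP => UB.
  have /BS : S° (map_mx intr (row i U) *m B).
    apply: double_ball_interior; rewrite map_row -row_mul.
    move: UB; rewrite gramE; congr (is_true (_ < _)).
    by apply: eq_bigr => k _; rewrite [in RHS]mxE.
  by apply/eqP; apply: unit_row_neq0.
move=> H; rewrite -(@ler_pXn2r _ 2) ?nnegrE // real_normK ?num_real //; lra.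
Qed.

(* A basis of twice the Hurwitz quaternions. *)
Definition hurwitz_basis : 'M[R]_4 := \matrix_(i,
  j) if i == ord_max then 1 else 2 *+ (i == j).

Lemma det_hurwitz_basis : \det hurwitz_basis = 8.
Proof.
rewrite det_trig; first by rewrite !big_ord_recl big_ord0 !mxE /=; ring.
apply/is_trig_mxP => i j ij; rewrite mxE ifF; last first.
  by apply/negbTE; apply: contraTneq ij => ->; rewrite -leqNgt -ltnS.
by rewrite (_ : i == j = false) //; apply/negbTE; rewrite -val_eqE ltn_eqF.
Qed.

(** Hurwitz quaternions have integral norm; hence no vector of this lattice has squared norm
    strictly between 0 and 4. *)
Lemma sqnorm_hurwitz (z : 'rV[int]_4) : exists q : int,
  sqnorm (map_mx intr z *m hurwitz_basis) = 4 * q%:~R.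
Proof.
pose i0 : 'I_4 := ord0; pose i1 : 'I_4 := lift ord0 ord0.
pose i2 : 'I_4 := lift ord0 (lift ord0 ord0).
pose i3 : 'I_4 := lift ord0 (lift ord0 (lift ord0 ord0)).
exists (z 0 i0 ^+ 2 + z 0 i1 ^+ 2 + z 0 i2 ^+ 2 + z 0 i3 ^+ 2
  + (z 0 i0 + z 0 i1 + z 0 i2) * z 0 i3).
rewrite /sqnorm !big_ord_recl big_ord0 !mxE !big_ord_recl !big_ord0 !mxE /=.
rewrite -/i0 -/i1 -/i2 -/i3. ring.
Qed.

Theorem critical_determinant_ball : critical_determinant S = 8.
Proof.
have h8 : `|\det hurwitz_basis| = 8 by rewrite det_hurwitz_basis ger0_norm.
have uH : hurwitz_basis \in unitmx by rewrite unitmxE unitfE det_hurwitz_basis.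
have HS (z : 'rV[int]_4) : S° (map_mx intr z *m hurwitz_basis) -> z = 0.
  move=> /interior_double_ball; have [q qE] := sqnorm_hurwitz z.
  have := sqnorm_ge0 (map_mx intr z *m hurwitz_basis); rewrite qE => q0 q4.
  have q1 : (q < 1)%R by rewrite -(@ltr_int R); lra.
  have : (0 <= q)%R by rewrite -(@ler_int R); lra.
  rewrite le_eqVlt -[_ < _]/(1 <= q)%R leNgt q1 orbF => /eqP q00.
  apply: (comb_eq0 uH); apply/eqP; rewrite -sqnorm_eq0 qE -q00 mulr0//.
apply/eqP; rewrite eq_le; apply/andP; split; first
  by rewrite -h8 critical_determinant_le.
apply: lb_le_inf.
  by exists `|\det hurwitz_basis|; apply: basis_mem_critical_set.
move=> _ [L [[B LB] LS] <-]; rewrite (covolE LB); case: LB => uB LE.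
apply: (ball_lattice_det_ge uB) => z zS; apply: (comb_eq0 uB).
apply: contrapT => z0; have : ((L `\ 0) `&` S°) (map_mx intr z *m B).
  by split=> //; split=> //; rewrite LE; exists z.
by rewrite LS.
Qed.

End Ball.

(** * The icosian lattice and the product of two balls *)

Section Product.
Variable R : realType.

Lemma interior_prod_double_ball (m n : nat) (x : 'rV[R]_m) (y : 'rV[R]_n) :
  (cart_prod [set 2 *: x | x in @unit_ball R m] [set 2 *: y | y in @unit_ball R
    n])° (row_mx x y) ->
  sqnorm x < 4 /\ sqnorm y < 4.
Proof.
move=> /interior_dilate [a a1 [x' Sx [y' Sy]]];
  rewrite scale_row_mx => /eq_row_mx[xE yE].
have a2 : 1 < a ^+ 2 by rewrite expr_gt1 // ltW // (lt_trans ltr01).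
have dil n' (v : 'rV[R]_n') : sqnorm (a *: v) <= 4 -> sqnorm v < 4.
  rewrite sqnormZ => ax; have [x0|x0] := leP (sqnorm v) 0; first
    by rewrite (le_lt_trans x0).
  by rewrite (lt_le_trans _ ax) // ltr_pMl.
by split; apply: dil; rewrite -?xE -?yE; apply/double_ballE.
Qed.

(* For [t] the golden ratio, a basis over [Z[t]] of the icosians. *)
Definition icosian_basis (t : R) : 'M[R]_4 := \matrix_(i, j)
  nth 0 (nth [::] [:: [:: 1]; [:: 0; 1]; [:: t / 2; (t - 1) / 2; 1 / 2];
     [:: 1 / 2; 1 / 2; 1 / 2; 1 / 2]] i) j.

Lemma det_icosian_basis t : \det (icosian_basis t) = 1 / 4.
Proof.
rewrite det_trig; first by rewrite !big_ord_recl big_ord0 !mxE /=; field.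
by apply/is_trig_mxP => -[[|[|[|[|//]]]] ?] [[|[|[|[|//]]]] ?] //= _; rewrite mxE.
Qed.

(** The integers [P] and [Q] are chosen before [t], so they serve both roots: the norm of the
    conjugate is the conjugate of the norm. *)
Lemma sqnorm_icosian (x y : 'rV[int]_4) : exists P Q : int, forall t : R, t ^+ 2 =
  t + 1 ->
  sqnorm ((map_mx intr x + t *: map_mx intr y) *m icosian_basis t) =
    P%:~R + Q%:~R * t.
Proof.
pose i0 : 'I_4 := ord0; pose i1 : 'I_4 := lift ord0 ord0.
pose i2 : 'I_4 := lift ord0 (lift ord0 ord0).
pose i3 : 'I_4 := lift ord0 (lift ord0 (lift ord0 ord0)).
pose x0 := x 0 i0; pose x1 := x 0 i1; pose x2 := x 0 i2; pose x3 := x 0 i3.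
pose y0 := y 0 i0; pose y1 := y 0 i1; pose y2 := y 0 i2; pose y3 := y 0 i3.
(* [p] and [q] are the coefficients of 1 and [t] in the product of [a + b t] and [c + d t].
   Multiplication by [t] takes them to [q] and [p + q], and by [t - 1] to [q - p] and [p]. *)
pose p (a b c d : int) := a * c + b * d.
pose q (a b c d : int) := a * d + b * c + b * d.
exists (p x0 y0 x0 y0 + p x1 y1 x1 y1 + p x2 y2 x2 y2 + p x3 y3 x3 y3
  + q x0 y0 x2 y2 + (q x1 y1 x2 y2 - p x1 y1 x2 y2) + p x0 y0 x3 y3 + p x1 y1 x3 y3
    + q x2 y2 x3 y3).
exists (q x0 y0 x0 y0 + q x1 y1 x1 y1 + q x2 y2 x2 y2 + q x3 y3 x3 y3
  + (p x0 y0 x2 y2 + q x0 y0 x2 y2) + p x1 y1 x2 y2 + q x0 y0 x3 y3 + q x1 y1 x3 y3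
    + (p x2 y2 x3 y3 + q x2 y2 x3 y3)).
move=> t t2.
rewrite /sqnorm !big_ord_recl big_ord0 !mxE !big_ord_recl !big_ord0 !mxE /=.
rewrite -/i0 -/i1 -/i2 -/i3 -/x0 -/x1 -/x2 -/x3 -/y0 -/y1 -/y2 -/y3 /p /q.
rewrite !(rmorphD, rmorphB, rmorphN, rmorphM) /=.
(* Equality modulo the minimal polynomial of [t], with an explicit cofactor [K]. *)
have modt K (a b : R) : a - b = K * (t ^+ 2 - t - 1) -> a = b.
  rewrite (_ : t ^+ 2 - t - 1 = 0) ?mulr0; last by rewrite t2; ring.
  by move/eqP; rewrite subr_eq0 => /eqP.
have mulE (a b c d : R) : (a + t * b) * (c + t * d) =
  a * c + b * d + (a * d + b * c + b * d) * t.
  by apply: (modt (b * d)); ring.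
set A0 := x0%:~R + t * y0%:~R; set A1 := x1%:~R + t * y1%:~R.
set A2 := x2%:~R + t * y2%:~R; set A3 := x3%:~R + t * y3%:~R.
transitivity (A0 * A0 + A1 * A1 + A2 * A2 + A3 * A3 + t * (A0 * A2) + (t - 1) * (A1
  * A2)
  + A0 * A3 + A1 * A3 + t * (A2 * A3)).
  by apply: (modt (A2 ^+ 2 / 2)); field.
rewrite /A0 /A1 /A2 /A3 !mulE.
move: (x0%:~R) (x1%:~R) (x2%:~R) (x3%:~R) (y0%:~R) (y1%:~R) (y2%:~R) (y3%:~R) =>
  a b c d k l m n.
by apply: (modt ((a * m + k * c + k * m) + (b * m + l * c + l * m) + (c * n + m * d
  + m * n))); ring.
Qed.

(** The two values differ by [Q (2 t - 1)], and [2 t - 1] is the square root of 5, which leaves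
    [Q = 0] or [Q = -1]. In the latter case the first condition asks for [P = 2]; but [2 - t] has
    conjugate exactly [t ^+ 2], which the strict bound excludes. *)
Lemma golden_totally_small (t : R) (P Q : int) : 0 < t -> t ^+ 2 = t + 1 ->
  0 <= P%:~R + Q%:~R * t < 1 -> 0 <= P%:~R + Q%:~R * (1 - t) < t ^+ 2 ->
    P = 0 /\ Q = 0.
Proof.
move=> t0 t2 /andP[a0 a1] /andP[b0 b1].
have t16 : 16 / 10 < t by nra.
have t17 : t < 17 / 10 by nra.
have Q1 : Q < 1 by rewrite -(@ltr_int R) ltNge; apply/negP => ?; nra.
have Q2 : -2 < Q by rewrite -(@ltr_int R) ltNge; apply/negP => ?; nra.
have [Q0|Q0] : Q = 0 \/ Q = -1 by lia.
  rewrite Q0 mul0r addr0 in a0 a1.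
  have : -1 < P by rewrite -(ltr_int R); lra.
  have : P < 1 by rewrite -(ltr_int R); lra.
  by split=> //; lia.
exfalso; rewrite Q0 rmorphN /= in a0 a1 b0 b1.
have : 1 < P by rewrite -(ltr_int R); lra.
have : P < 2 by rewrite -(ltr_int R); lra.
lia.
Qed.

Theorem critical_determinant_prod_ball (t : R) : 0 < t -> t ^+ 2 = t + 1 ->
  critical_determinant (cart_prod [set 2 *: x | x in @unit_ball R 4] [set 2 *: x |
    x in @unit_ball R 4])
   <= 400 / t ^+ 4.
Proof.
move=> t0 t2; pose u := 1 - t.
have u2 : u ^+ 2 = u + 1 by rewrite /u; nra.
have tn0 : t != 0 by rewrite gt_eqF.
(* The lower rows are the upper ones times the golden ratio, which acts as [t] on the first factor
   and as its conjugate [u] on the second. *)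
pose B : 'M[R]_(4 + 4) :=
  block_mx (2 *: icosian_basis t) ((2 / t) *: icosian_basis u)
    ((2 * t) *: icosian_basis t) ((2 * u / t) *: icosian_basis u).
have detB : \det B = 400 / t ^+ 4.
  (* Subtracting [t] times the upper rows leaves a block triangular matrix with [u - t] in its last
     block, and [(u - t) ^+ 2 = 5]. *)
  have -> : B = block_mx 1%:M 0 t%:M 1%:M *m
     block_mx (2 *: icosian_basis t) ((2 / t) *: icosian_basis u)
       0 ((2 * (u - t) / t) *: icosian_basis u).
    rewrite mulmx_block !mul1mx !mul0mx !addr0 !mul_scalar_mx !scalerA -scalerDl.
    congr (block_mx _ _ (_ *: _) (_ *: _)); first by rewrite mulrC.
    by field.
  rewrite det_mulmx det_lblock det_ublock !det1 !mul1r !detZ !det_icosian_basis.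
  have : (u - t) ^+ 2 = 5 by rewrite /u; nra.
  move=> ut; have ut4 : (u - t) ^+ 4 = 25 by rewrite (exprM _ 2 2) ut; ring.
  rewrite expr_div_n exprMn ut4; field; done.
have d0 : 0 < 400 / t ^+ 4 by rewrite divr_gt0 ?exprn_gt0 ?ltr0n.
have uB : B \in unitmx by rewrite unitmxE unitfE detB gt_eqF.
have -> : 400 / t ^+ 4 = `|\det B| by rewrite detB gtr0_norm.
apply: (critical_determinant_le uB) => z zT; apply: (comb_eq0 uB).
have [P [Q PQ]] := sqnorm_icosian (lsubmx z) (rsubmx z).
pose v s := (map_mx intr (lsubmx z) + s *: map_mx intr (rsubmx z)) *m icosian_basis
  s.
have zB : map_mx intr z *m B = row_mx (2 *: v t) ((2 / t) *: v u).
  rewrite -{1}[z]hsubmxK map_row_mx mul_row_block /v !mulmxDl !scalerDr.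
  by rewrite -!scalemxAl -!scalemxAr !scalerA ![2 / t * u]mulrAC.
move: zT; rewrite zB => /interior_prod_double_ball[].
have vE s : s ^+ 2 = s + 1 -> sqnorm (v s) = P%:~R + Q%:~R * s by exact: PQ.
rewrite !sqnormZ !vE // => xt yu.
have tsq : (2 / t) ^+ 2 = 4 / t ^+ 2 by field.
have [P0 Q0] : P = 0 /\ Q = 0.
  apply: (@golden_totally_small t) => //.
    by rewrite -vE // sqnorm_ge0 vE //=; lra.
  rewrite -/u -vE // sqnorm_ge0 vE //=.
  move: yu; rewrite tsq mulrAC ltr_pdivrMr ?exprn_gt0 //; lra.
have v0 s : s ^+ 2 = s + 1 -> v s = 0.
  by move=> s2; apply/eqP; rewrite -sqnorm_eq0 vE // P0 Q0 mul0r addr0.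
by rewrite !v0 // !scaler0 row_mx0.
Qed.
End Product.

(** * Closed form and decimal expansion of the bound *)

Theorem corollary11 (R : realType) :
  let S : set 'rV[R]_4 := [set 2 *: x | x in @unit_ball R 4] in
  let c : R := 256 / (1 + 1 / Num.sqrt 5) ^+ 4 in
  let d : R := 58 + 359 / 10 ^+ 3 + 213 / 10 ^+ 6 in
  critical_determinant (cart_prod S S) < critical_determinant S ^+ 2 /\
  [/\ critical_determinant (cart_prod S S) <= c,
      d <= c < d + 1 / 10 ^+ 6,
      c < 64
    & 64 = critical_determinant S ^+ 2].
Proof.
move=> S c d; rewrite (critical_determinant_ball R).
have s5 : Num.sqrt 5 ^+ 2 = 5 :> R by rewrite sqr_sqrtr.
have s_ge0 : 0 <= Num.sqrt 5 :> R by exact: sqrtr_ge0.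
pose t : R := (1 + Num.sqrt 5) / 2.
have t0 : 0 < t by rewrite /t; lra.
have t2 : t ^+ 2 = t + 1 by rewrite /t; nra.
have prod_le := critical_determinant_prod_ball t0 t2.
have sV : 1 / Num.sqrt 5 = Num.sqrt 5 / 5 :> R.
  by apply: canLR (mulfK _) _; [rewrite gt_eqF // sqrtr_gt0|lra].
have cE : c = 1400 - 600 * Num.sqrt 5.
  have den4 : (1 + 1 / Num.sqrt 5) ^+ 4 = (56 + 24 * Num.sqrt 5) / 25 :> R.
    have den2 : (1 + 1 / Num.sqrt 5) ^+ 2 = (6 + 2 * Num.sqrt 5) / 5 :> R.
      by rewrite sV; lra.
    by rewrite (exprM _ 2 2) den2; lra.
  by rewrite /c den4; apply: canLR (mulfK _) _; [rewrite gt_eqF //|]; lra.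
(* Indeed [1 + 1 / Num.sqrt 5 = 2 * t / Num.sqrt 5], and [256 * 25 / 16 = 400]. *)
have ct : 400 / t ^+ 4 = c.
  have t4 : t ^+ 4 = (7 + 3 * Num.sqrt 5) / 2 by rewrite (exprM _ 2 2) t2 /t; lra.
  by rewrite cE t4; apply: canLR (mulfK _) _; [rewrite gt_eqF //|]; lra.
(* Nine decimals are taken because [c = 1400 - 600 * Num.sqrt 5] magnifies the error 600 times and
   six decimals of [c] are claimed. *)
have s_gt : 2 + 236 / 10 ^+ 3 + 67 / 10 ^+ 6 + 977 / 10 ^+ 9 < Num.sqrt 5 :> R
  by nra.
have s_lt : Num.sqrt 5 < 2 + 236 / 10 ^+ 3 + 67 / 10 ^+ 6 + 978 / 10 ^+ 9 :> R
  by nra.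
rewrite ct -/S in prod_le.
have c_lt : c < 64 by lra.
do ?split => //; [lra | rewrite cE /d; lra| lra].
Qed.
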